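(* Let $\mathcal{Q}=(X,q,G,(\cdot,g,(\chi_l)_{l\in X}),(\lambda_C)_{C\in\mathcal{R}'})$ be a quadratic lifting datum and $\mathcal{H}(\mathcal{Q})$ the associated Hopf algebra. Let $\rho\in\operatorname{Hom}(G,\Bbbk^* )$. In what follows, for $C\in\mathcal{R}'$, the pair $(i,j)\in C$ is the one used to form $\phi_C$. There exists an algebra morphism $\bar\rho:\mathcal{H}(\mathcal{Q})\to\Bbbk$ with $\bar\rho(H_t)=\rho(t)$ for all $t\in G$ (an extension of $\rho$) if and only if (1) $0=\lambda_C(1-\rho(g_ig_j))$ for every $C\in\mathcal{R}'$ with $n(C)$ even, $(i,j)\in C$; and there exists a family $\{\gamma_i\}_{i\in X}$ of scalars in $\Bbbk$ such that (2) $\gamma_j=\chi_j(t)\gamma_{t\cdot j}$ for all $t\in G$, $j\in X$; (3) $\gamma_i\gamma_j=\lambda_C(1-\rho(g_ig_j))$ for every $C\in\mathcal{R}'$ with $n(C)$ odd, $(i,j)\in C$. If (1) holds, then the set of all extensions $\bar\rho$ of $\rho$ is in bijective correspondence with the set of families $\{\gamma_i\}_{i\in X}$ satisfying (2) and (3) (with $\gamma_i=\bar\rho(a_i)$). In particular, if for all $C\in\mathcal{R}'$, $(i,j)\in C$, one has $\lambda_C\neq0\Rightarrow\rho(g_ig_j)=1$, then $\gamma_i=0$ for all $i\in X$ defines an $\mathcal{H}(\mathcal{Q})$-module. Moreover, this is the only possible extension if, in addition, $\chi_i(g_i)\neq 1$ for all $i\in X$.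
   Context: $\Bbbk$ is an algebraically closed field of characteristic zero. A rack is a non-empty set $X$ with a map $\rhd:X\times X\to X$ such that each $i\rhd(\cdot)$ is bijective and $i\rhd(j\rhd k)=(i\rhd j)\rhd(i\rhd k)$; all racks are assumed to satisfy $i\rhd i=i$. A 2-cocycle is a map $q:X\times X\to\Bbbk^*$, $(i,j)\mapsto q_{ij}$, with $q_{i,j\rhd k}q_{j,k}=q_{i\rhd j,i\rhd k}q_{i,k}$. A principal YD-realization of $(X,q)$ over a finite group $G$ is $(\cdot,g,(\chi_i)_{i\in X})$ with: $\cdot$ an action of $G$ on $X$; $g:X\to G$ with $g_{h\cdot i}=hg_ih^{-1}$ and $g_i\cdot j=i\rhd j$; maps $\chi_i:G\to\Bbbk^*$ with $\chi_i(ht)=\chi_i(t)\chi_{t\cdot i}(h)$ and $\chi_i(g_j)=q_{ji}$. $\mathcal{R}$ is the set of equivalence classes in $X\times X$ for the relation generated by $(i,j)\sim(i\rhd j,i)$. For $C\in\mathcal{R}$ with chosen $(i,j)\in C$ put $i_1=j$, $i_2=i$, $i_{h+2}=i_{h+1}\rhd i_h$; $n(C)=\#C$; $\mathcal{R}'=\{C\in\mathcal{R}:\prod_{h=1}^{n(C)}q_{i_{h+1},i_h}=(-1)^{n(C)}\}$. For $C\in\mathcal{R}'$ (with the chosen pair $(i,j)=(i_2,i_1)$) let $\phi_C=\sum_{h=1}^{n(C)}\eta_h(C)T_{i_{h+1}}T_{i_h}$ in the free algebra on $\{T_l\}_{l\in X}$, where $\eta_1(C)=1$ and $\eta_h(C)=(-1)^{h+1}q_{i_2i_1}q_{i_3i_2}\cdots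 q_{i_hi_{h-1}}$ for $h\geq2$. A quadratic lifting datum $\mathcal{Q}=(X,q,G,(\cdot,g,(\chi_l)_{l\in X}),(\lambda_C)_{C\in\mathcal{R}'})$ consists of a rack $X$, a 2-cocycle $q$, a finite group $G$, a principal YD-realization of $(X,q)$ over $G$ with $g_i\neq g_jg_k$ for all $i,j,k\in X$, and scalars $\lambda_C\in\Bbbk$ such that for $C\in\mathcal{R}'$ and $k\in X$: $\lambda_C=0$ if $g_{i_2}g_{i_1}=1$, and $\lambda_C=q_{ki_2}q_{ki_1}\lambda_{k\rhd C}$, where $k\rhd C=\{(k\rhd i,k\rhd j):(i,j)\in C\}$. $\mathcal{H}(\mathcal{Q})$ is the algebra generated by $\{a_l,H_t:l\in X,t\in G\}$ with relations $H_e=1$, $H_tH_s=H_{ts}$; $H_ta_l=\chi_l(t)a_{t\cdot l}H_t$; $\phi_C(\{a_l\}_{l\in X})=\lambda_C(1-H_{g_ig_j})$ for $C\in\mathcal{R}'$, $(i,j)\in C$. It is a pointed Hopf algebra with $\Delta(H_t)=H_t\otimes H_t$, $\Delta(a_i)=g_i\otimes a_i+a_i\otimes1$ (here $g_i$ stands for $H_{g_i}$). *)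

(* Defs.v *)
From HB Require Import structures.
From Stdlib Require Import Relation_Operators.
From mathcomp Require Import all_boot all_order all_algebra all_fingroup.
From mathcomp Require Import generic_quotient finmap.
From mathcomp Require Import boolp classical_sets functions cardinality.
From mathcomp.multinomials Require Import monalg.

Set Implicit Arguments.
Unset Strict Implicit.
Unset Printing Implicit Defensive.

Import GRing.Theory.

Local Open Scope classical_set_scope.
Local Open Scope quotient_scope.
Local Open Scope ring_scope.

Section QuotientAlgebra.
Variables (k : fieldType) (A : algType k).

Definition two_sided_ideal (J : set A) : Prop :=
  [/\ J 0, forall x y, J x -> J y -> J (x + y) &
      forall a x b, J x -> J (a * x * b)].

Definition ideal_generated_by (S : set A) : set A :=
  [set x | forall J, two_sided_ideal J -> S `<=` J -> J x].

Lemma ideal_generated_by_ideal S : two_sided_ideal (ideal_generated_by S).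
Proof.
split=> [J [J0 _ _] _ //|x y Sx Sy J HJ SJ|a x b Sx J HJ SJ].
  by case: (HJ) => _ JD _; apply: JD; [apply: Sx | apply: Sy].
by case: (HJ) => _ _ JM; apply: JM; apply: Sx.
Qed.

Record proper_two_sided_ideal := ProperTwoSidedIdeal {
  ideal_set :> set A;
  ideal_closed : two_sided_ideal ideal_set;
  ideal_proper : ~ ideal_set 1
}.

Variable J : proper_two_sided_ideal.

Let J0 : ideal_set J 0. Proof. by case: (ideal_closed J). Qed.
Let JD x y : ideal_set J x -> ideal_set J y -> ideal_set J (x + y).
Proof. by case: (ideal_closed J) => _ + _; apply. Qed.
Let JMl a x : ideal_set J x -> ideal_set J (a * x).
Proof.
by case: (ideal_closed J) => _ _ JM Jx; rewrite -[a * x]mulr1; apply: JM.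
Qed.
Let JMr x a : ideal_set J x -> ideal_set J (x * a).
Proof.
by case: (ideal_closed J) => _ _ JM Jx; rewrite -[x]mul1r; apply: JM.
Qed.
Let JN x : ideal_set J x -> ideal_set J (- x).
Proof. by move=> Jx; rewrite -mulN1r; apply: JMl. Qed.

Definition ideal_equiv : rel A := fun x y => `[< ideal_set J (x - y) >].

Lemma ideal_equiv_is_equiv : equiv_class_of ideal_equiv.
Proof.
split=> [x|x y|y x z].
- by apply/asboolP; rewrite subrr.
- by apply/asboolP/asboolP => /JN; rewrite opprB.
- move=> /asboolP xy /asboolP yz; apply/asboolP.
  by rewrite -[x](subrK y) -addrA; apply: JD.
Qed.

Canonical ideal_equiv_equiv := EquivRelPack ideal_equiv_is_equiv.
Canonical ideal_equiv_encModRel := defaultEncModRel ideal_equiv.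

Definition quotient_algebra := {eq_quot ideal_equiv}.
HB.instance Definition _ := Choice.on quotient_algebra.
HB.instance Definition _ := EqQuotient.on quotient_algebra.

Local Notation Q := quotient_algebra.

Lemma quotient_piP x y : reflect (ideal_set J (x - y)) (x == y %[mod Q]).
Proof. by rewrite eqmodE; apply: asboolP. Qed.

Let eqQ x y : ideal_set J (x - y) -> \pi_Q x = \pi_Q y.
Proof. by move=> ?; apply/eqP/quotient_piP. Qed.
Let reprJ x : ideal_set J (repr (\pi_Q x) - x).
Proof. by apply/quotient_piP; rewrite reprK. Qed.

Definition quotient_zero : Q := \pi_Q 0.
Definition quotient_one : Q := \pi_Q 1.
Definition quotient_opp (x : Q) : Q := \pi_Q (- repr x).
Definition quotient_add (x y : Q) : Q := \pi_Q (repr x + repr y).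
Definition quotient_mul (x y : Q) : Q := \pi_Q (repr x * repr y).
Definition quotient_scale (c : k) (x : Q) : Q := \pi_Q (c *: repr x).

Let oppE x : quotient_opp (\pi_Q x) = \pi_Q (- x).
Proof. by apply: eqQ; rewrite opprK addrC -opprB; apply: JN. Qed.
Let addE x y : quotient_add (\pi_Q x) (\pi_Q y) = \pi_Q (x + y).
Proof. by apply: eqQ; rewrite opprD addrACA; apply: JD. Qed.
Let mulE x y : quotient_mul (\pi_Q x) (\pi_Q y) = \pi_Q (x * y).
Proof.
apply: eqQ; set x' := repr _; set y' := repr _.
have -> : x' * y' - x * y = (x' - x) * y' + x * (y' - y).
  by rewrite mulrBl mulrBr addrA subrK.
by apply: JD; [apply: JMr; apply: reprJ | apply: JMl; apply: reprJ].
Qed.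
Let scaleE c x : quotient_scale c (\pi_Q x) = \pi_Q (c *: x).
Proof.
apply: eqQ; rewrite -scalerBr -[_ - x]mul1r scalerAl; apply: JMl; exact: reprJ.
Qed.

Let proj_ind (P : Q -> Prop) : (forall x, P (\pi_Q x)) -> forall y, P y.
Proof. by move=> H y; rewrite -[y]reprK. Qed.

Let addA : associative quotient_add.
Proof.
elim/proj_ind=> x; elim/proj_ind=> y; elim/proj_ind=> z.
by rewrite (addE y z) (addE x y) addE addE addrA.
Qed.
Let addC : commutative quotient_add.
Proof.
elim/proj_ind=> x; elim/proj_ind=> y.
by rewrite (addE x y) (addE y x) addrC.
Qed.
Let add0 : left_id quotient_zero quotient_add.
Proof. by elim/proj_ind=> x; rewrite addE add0r. Qed.
Let addN : left_inverse quotient_zero quotient_opp quotient_add.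
Proof. by elim/proj_ind=> x; rewrite (oppE x) addE addNr. Qed.

HB.instance Definition _ := GRing.isZmodule.Build Q addA addC add0 addN.

Let mulA : associative quotient_mul.
Proof.
elim/proj_ind=> x; elim/proj_ind=> y; elim/proj_ind=> z.
by rewrite (mulE y z) (mulE x y) mulE mulE mulrA.
Qed.
Let mul1 : left_id quotient_one quotient_mul.
Proof. by elim/proj_ind=> x; rewrite mulE mul1r. Qed.
Let mulx1 : right_id quotient_one quotient_mul.
Proof. by elim/proj_ind=> x; rewrite mulE mulr1. Qed.
Let mulDl : left_distributive quotient_mul quotient_add.
Proof.
elim/proj_ind=> x; elim/proj_ind=> y; elim/proj_ind=> z.
by rewrite (addE x y) (mulE x z) (mulE y z) mulE addE mulrDl.
Qed.
Let mulDr : right_distributive quotient_mul quotient_add.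
Proof.
elim/proj_ind=> x; elim/proj_ind=> y; elim/proj_ind=> z.
by rewrite (addE y z) (mulE x z) (mulE x y) mulE addE mulrDr.
Qed.
Let one_neq0 : quotient_one != 0.
Proof.
by apply/negP => /quotient_piP; rewrite subr0; apply: (@ideal_proper J).
Qed.

HB.instance Definition _ :=
  GRing.Zmodule_isNzRing.Build Q mulA mul1 mulx1 mulDl mulDr one_neq0.

Let scaleA a b (v : Q) :
  quotient_scale a (quotient_scale b v) = quotient_scale (a * b) v.
Proof.
elim/proj_ind: v => x.
by rewrite (scaleE b x) (scaleE (a * b) x) scaleE scalerA.
Qed.
Let scale1 : left_id 1 quotient_scale.
Proof. by elim/proj_ind=> x; rewrite scaleE scale1r. Qed.
Let scaleDr : right_distributive quotient_scale +%R.
Proof.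
move=> c; elim/proj_ind=> x; elim/proj_ind=> y.
rewrite -[LHS]/(quotient_scale c (quotient_add _ _)) -[RHS]/(quotient_add _ _).
by rewrite (addE x y) (scaleE c x) (scaleE c y) scaleE addE scalerDr.
Qed.
Let scaleDl (v : Q) : {morph quotient_scale^~ v : a b / a + b}.
Proof.
move=> a b; elim/proj_ind: v => x; rewrite -[RHS]/(quotient_add _ _).
by rewrite (scaleE (a + b) x) (scaleE a x) (scaleE b x) addE scalerDl.
Qed.

HB.instance Definition _ :=
  GRing.Zmodule_isLmodule.Build k Q scaleA scale1 scaleDr scaleDl.

Let scaleAl (c : k) (x y : Q) : c *: (x * y) = (c *: x) * y.
Proof.
elim/proj_ind: x => x; elim/proj_ind: y => y.
rewrite -[LHS]/(quotient_scale c (quotient_mul _ _)).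
rewrite -[RHS]/(quotient_mul (quotient_scale _ _) _).
by rewrite (mulE x y) (scaleE c x) scaleE mulE scalerAl.
Qed.

HB.instance Definition _ := GRing.Lmodule_isLalgebra.Build k Q scaleAl.

Let scaleAr (c : k) (x y : Q) : c *: (x * y) = x * (c *: y).
Proof.
elim/proj_ind: x => x; elim/proj_ind: y => y.
rewrite -[LHS]/(quotient_scale c (quotient_mul _ _)).
rewrite -[RHS]/(quotient_mul _ (quotient_scale _ _)).
by rewrite (mulE x y) (scaleE c y) scaleE mulE scalerAr.
Qed.

HB.instance Definition _ := GRing.Lalgebra_isAlgebra.Build k Q scaleAr.

Definition quotient_proj (x : A) : Q := \pi_Q x.

Lemma quotient_proj_is_linear : linear quotient_proj.
Proof.
move=> c x y; rewrite /quotient_proj.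
rewrite -[_ *: \pi_Q _]/(quotient_scale _ _) -[(_ : Q) + _]/(quotient_add _ _).
by rewrite scaleE addE.
Qed.
Lemma quotient_proj_is_monoid_morphism : monoid_morphism quotient_proj.
Proof. by split=> // x y; rewrite -[RHS]/(quotient_mul _ _) mulE. Qed.

HB.instance Definition _ :=
  GRing.isLinear.Build k A Q *:%R quotient_proj quotient_proj_is_linear.
HB.instance Definition _ :=
  GRing.isMonoidMorphism.Build A Q quotient_proj
    quotient_proj_is_monoid_morphism.

Lemma quotient_projP x : reflect (ideal_set J x) (quotient_proj x == 0).
Proof. by rewrite -{1}[x]subr0; apply: quotient_piP. Qed.

Lemma quotient_proj_surj (y : Q) : exists x, y = quotient_proj x.
Proof. by exists (repr y); rewrite /quotient_proj reprK. Qed.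

End QuotientAlgebra.

Section FreeAlgebra.
Variables (k : fieldType) (I : choiceType).

Definition free_algebra := {malg k[{fmonom I}]}.
HB.instance Definition _ := GRing.Lalgebra.on free_algebra.

Lemma free_algebra_scaleAr (c : k) (x y : free_algebra) :
  c *: (x * y) = x * (c *: y).
Proof.
have cC (z : free_algebra) : z * (mkmalgU mone c : free_algebra) = c *: z.
  rewrite [LHS]malgM_def [RHS]malgZ_def fgmulgU; apply: eq_bigr => m _.
  by rewrite mulm1 mulrC.
by rewrite -cC -mulrA cC.
Qed.

HB.instance Definition _ :=
  GRing.Lalgebra_isAlgebra.Build k free_algebra free_algebra_scaleAr.

Definition free_gen (i : I) : free_algebra := mkmalgU (fmu i) 1.

Section Eval.
Variable w : I -> k.

Definition word_eval (m : {fmonom I}) : k := \prod_(i <- m : seq I) w i.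

Lemma word_eval_mmorphism : mmorphism word_eval.
Proof.
split=> [x y|]; rewrite /word_eval; last by rewrite fm1 big_nil.
by rewrite fmM big_cat.
Qed.

HB.instance Definition _ :=
  monalg.isMultiplicative.Build {fmonom I} k word_eval word_eval_mmorphism.

Definition free_eval (x : free_algebra) : k := mmap idfun word_eval x.

HB.instance Definition _ := GRing.RMorphism.copy free_eval
  (mmap idfun word_eval : {malg k[{fmonom I}]} -> k).
HB.instance Definition _ := GRing.Linear.copy free_eval
  (mmap idfun word_eval : {malg k[{fmonom I}]} -> k).

Lemma free_evalZ c x : free_eval (c *: x) = c * free_eval x.
Proof. exact: linearZ. Qed.

Lemma free_eval_gen i : free_eval (free_gen i) = w i.
Proof.
rewrite /free_eval /free_gen mmapU /= mul1r /word_eval.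
by rewrite fmuE big_seq1.
Qed.
End Eval.

End FreeAlgebra.

Section Racks.
Variables (X : choiceType) (op : X -> X -> X).

Definition is_rack : Prop :=
  [/\ [set: X] !=set0,
      forall i, bijective (op i),
      forall i j l, op i (op j l) = op (op i j) (op i l) &
      forall i, op i i = i].

Definition pair_step (p p' : X * X) : Prop := p' = (op p.1 p.2, p.1).

Definition pair_class (p : X * X) : set (X * X) :=
  [set p' | clos_refl_sym_trans (X * X) pair_step p p'].

Definition pair_classes : set (set (X * X)) := range pair_class.

Definition translate_class (l : X) (C : set (X * X)) : set (X * X) :=
  [set (op l p.1, op l p.2) | p in C].

(* Junk value 0 on infinite sets; see [ld_class_finite] below. *)
Definition class_size (C : set (X * X)) : nat := #|` fset_set C|%fset.

(* The indexing is shifted: class_seq (i, j) h is i_(h+1), so that its values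
   at 0 and 1 are i_1 = j and i_2 = i. *)
Fixpoint class_seq (p : X * X) (h : nat) : X :=
  match h with
  | 0 => p.2
  | h1.+1 => if h1 is h0.+1 then op (class_seq p h1) (class_seq p h0) else p.1
  end.

Section Cocycles.
Variables (k : fieldType) (q : X -> X -> k).

Definition is_cocycle : Prop :=
  (forall i j, q i j != 0) /\
  (forall i j l, q i (op j l) * q j l = q (op i j) (op i l) * q i l).

(* The chosen representative of each class. *)
Variable pick_pair : set (X * X) -> X * X.

Definition quadratic_classes : set (set (X * X)) :=
  [set C | pair_classes C /\
    \prod_(h < class_size C)
      q (class_seq (pick_pair C) h.+1) (class_seq (pick_pair C) h)
    = (-1) ^+ class_size C].

(* With the shifted indexing, eta C h is eta_(h+1)(C). *)
Definition eta (C : set (X * X)) (h : nat) : k :=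
  (-1) ^+ h *
  \prod_(m < h) q (class_seq (pick_pair C) m.+1) (class_seq (pick_pair C) m).

(* phi_C evaluated at the family T. *)
Definition phi (C : set (X * X)) (A : lalgType k) (T : X -> A) : A :=
  \sum_(h < class_size C) eta C h *:
    (T (class_seq (pick_pair C) h.+1) * T (class_seq (pick_pair C) h)).

End Cocycles.

End Racks.

Record YD_realization (k : fieldType) (X : choiceType) (op : X -> X -> X)
    (q : X -> X -> k) (G : finGroupType) := YDRealization {
  yd_act : G -> X -> X;
  yd_g : X -> G;
  yd_chi : X -> G -> k;
  yd_act1 : forall i, yd_act 1%g i = i;
  yd_actM : forall s t i, yd_act (s * t)%g i = yd_act s (yd_act t i);
  yd_g_act : forall t i, yd_g (yd_act t i) = (t * yd_g i * t^-1)%g;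
  yd_act_g : forall i j, yd_act (yd_g i) j = op i j;
  yd_chi_neq0 : forall i t, yd_chi i t != 0;
  yd_chiM : forall i s t,
    yd_chi i (s * t)%g = yd_chi i t * yd_chi (yd_act t i) s;
  yd_chi_g : forall i j, yd_chi i (yd_g j) = q j i
}.

(* [ld_pair] records the pairs chosen in the classes, on which the polynomials
   phi and the conditions on the scalars depend; its values outside
   [pair_classes], and those of [ld_lambda] outside [quadratic_classes], are
   irrelevant. *)
Record quadratic_lifting_datum (k : fieldType) := QuadraticLiftingDatum {
  ld_X : choiceType;
  ld_op : ld_X -> ld_X -> ld_X;
  ld_rack : is_rack ld_op;
  ld_q : ld_X -> ld_X -> k;
  ld_cocycle : is_cocycle ld_op ld_q;
  ld_pair : set (ld_X * ld_X) -> ld_X * ld_X;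
  ld_pairP : forall C, pair_classes ld_op C -> C (ld_pair C);
  ld_G : finGroupType;
  ld_yd : YD_realization ld_op ld_q ld_G;
  ld_g_neq : forall i j l, yd_g ld_yd i <> (yd_g ld_yd j * yd_g ld_yd l)%g;
  ld_lambda : set (ld_X * ld_X) -> k;
  ld_lambda0 : forall C, quadratic_classes ld_op ld_q ld_pair C ->
    (yd_g ld_yd (ld_pair C).1 * yd_g ld_yd (ld_pair C).2 = 1)%g ->
    ld_lambda C = 0;
  ld_lambda_act : forall C l, quadratic_classes ld_op ld_q ld_pair C ->
    ld_lambda C = ld_q l (ld_pair C).1 * ld_q l (ld_pair C).2 *
      ld_lambda (translate_class ld_op l C)
}.

Section LiftingAlgebra.
Variables (k : fieldType) (D : quadratic_lifting_datum k).

Definition ld_classes : set (set (ld_X D * ld_X D)) :=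
  quadratic_classes (@ld_op k D) (@ld_q k D) (@ld_pair k D).
Definition ld_phi (C : set (ld_X D * ld_X D)) (A : lalgType k)
  (T : ld_X D -> A) : A := phi (@ld_op k D) (@ld_q k D) (@ld_pair k D) C T.
Definition ld_act : ld_G D -> ld_X D -> ld_X D := yd_act (ld_yd D).
Definition ld_g : ld_X D -> ld_G D := yd_g (ld_yd D).
Definition ld_chi : ld_X D -> ld_G D -> k := yd_chi (ld_yd D).

(* g_i g_j for the pair (i, j) chosen in C; it is constant on C. *)
Definition ld_gg (C : set (ld_X D * ld_X D)) : ld_G D :=
  (ld_g (ld_pair C).1 * ld_g (ld_pair C).2)%g.

Lemma ld_class_finite C : pair_classes (@ld_op k D) C -> finite_set C.
Proof.
case=> -[i j] _ <-.
pose O := [set ld_act t i | t in setT] `|` [set ld_act t j | t in setT].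
have OG t x : O x -> O (ld_act t x).
  move=> [[s _ <-]|[s _ <-]]; rewrite /ld_act -yd_actM; [left|right];
  by exists (t * s)%g.
have finO : finite_set O.
  by rewrite finite_setU; split; apply: finite_image; apply: finite_finset.
apply: (@sub_finite_set _ _ (O `*` O)); last exact: finite_setX.
have inO p p' : clos_refl_sym_trans _ (pair_step (@ld_op k D)) p p' ->
    (O `*` O) p <-> (O `*` O) p'.
  elim=> {p p'} [[x y] _ ->|p|p p' _ IH|p p' p'' _ IH1 _ IH2] //=.
  - rewrite -(yd_act_g (ld_yd D)); split=> /= -[Ox Oy]; split=> //=.
      exact: OG.
    rewrite -[y](yd_act1 (ld_yd D)) -(mulVg (ld_g x)) yd_actM; exact: OG.
  - by split=> /IH.
  - exact: iff_trans IH1 IH2.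
move=> p /inO [+ _]; apply; split=> /=; [left|right];
by exists 1%g => //; apply: yd_act1.
Qed.

Definition ld_generators : choiceType := (ld_X D + ld_G D)%type.

Local Notation F := (free_algebra k ld_generators).

Definition free_a (l : ld_X D) : F := free_gen k (inl l : ld_generators).
Definition free_H (t : ld_G D) : F := free_gen k (inr t : ld_generators).

Local Notation a := free_a.
Local Notation H := free_H.

Inductive lifting_relator : F -> Prop :=
| relator_one : lifting_relator (H 1%g - 1)
| relator_mul t s : lifting_relator (H t * H s - H (t * s)%g)
| relator_act t l :
    lifting_relator (H t * a l - ld_chi l t *: (a (ld_act t l) * H t))
| relator_quad C : ld_classes C ->
    lifting_relator (ld_phi C a - ld_lambda C *: (1 - H (ld_gg C))).

Definition lifting_ideal_set : set F :=
  ideal_generated_by [set x | lifting_relator x].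

(* The values of the counit of the lifting algebra on the generators. *)
Definition counit_on_generators (x : ld_generators) : k :=
  if x is inr _ then 1 else 0.

Lemma counit_lifting_ideal (x : F) :
  lifting_ideal_set x -> free_eval counit_on_generators x = 0.
Proof.
have evH t : free_eval counit_on_generators (H t) = 1 by apply: free_eval_gen.
have eva l : free_eval counit_on_generators (a l) = 0 by apply: free_eval_gen.
move=> /(_ [set y | free_eval counit_on_generators y = 0]); apply.
  split=> [|y z y0 z0|y z t z0].
  - by rewrite /= raddf0.
  - by rewrite /= raddfD /= y0 z0 addr0.
  - by rewrite /= !rmorphM /= z0 mulr0 mul0r.
move=> y [|t s|t l|C _] /=.
- by rewrite rmorphB rmorph1 /= evH subrr.
- by rewrite rmorphB rmorphM /= !evH mulr1 subrr.
- rewrite rmorphB rmorphM /= free_evalZ rmorphM /= !eva.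
  by rewrite mulr0 mul0r mulr0 subrr.
- rewrite rmorphB /= free_evalZ rmorphB rmorph1 /= evH subrr mulr0 subr0.
  rewrite raddf_sum big1 //= => h _.
  by rewrite free_evalZ rmorphM /= !eva mulr0 mulr0.
Qed.

Lemma lifting_ideal_proper : ~ lifting_ideal_set 1.
Proof.
by move=> /counit_lifting_ideal; rewrite rmorph1 => /eqP; rewrite oner_eq0.
Qed.

Definition lifting_ideal : proper_two_sided_ideal F :=
  ProperTwoSidedIdeal (ideal_generated_by_ideal _) lifting_ideal_proper.

Definition lifting_algebra : algType k := quotient_algebra lifting_ideal.

Definition lifting_a (l : ld_X D) : lifting_algebra :=
  quotient_proj lifting_ideal (a l).
Definition lifting_H (t : ld_G D) : lifting_algebra :=
  quotient_proj lifting_ideal (H t).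

End LiftingAlgebra.

Section Extensions.
Variables (k : fieldType) (D : quadratic_lifting_datum k) (rho : ld_G D -> k).

Definition is_linear_character : Prop :=
  (forall t, rho t != 0) /\ {morph rho : s t / (s * t)%g >-> s * t}.

Definition extends (rhobar : {lrmorphism lifting_algebra D -> k^o}) : Prop :=
  forall t, rhobar (lifting_H t) = rho t.

Definition even_condition : Prop :=
  forall C, ld_classes C -> ~~ odd (class_size C) ->
    0 = ld_lambda C * (1 - rho (ld_gg C)).

Definition invariant_family (gamma : ld_X D -> k) : Prop :=
  forall t j, gamma j = ld_chi j t * gamma (ld_act t j).

Definition odd_condition (gamma : ld_X D -> k) : Prop :=
  forall C, ld_classes C -> odd (class_size C) ->
    gamma (ld_pair C).1 * gamma (ld_pair C).2 =
    ld_lambda C * (1 - rho (ld_gg C)).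

End Extensions.

(* Main.v *)
(* An extension of rho is determined by the scalars gamma_l it gives to the
   a_l, and the commutation relations say exactly that gamma is invariant (2).
   Taking t = g_i in (2) gives gamma_j = q_ij gamma_(i |> j), so the product
   gamma_(i_(h+1)) gamma_(i_h) absorbs q_(i_(h+1) i_h) when h grows by one, and
   the h-th term of phi_C(gamma) is (-1)^(h+1) gamma_(i_2) gamma_(i_1). The sum
   collapses to gamma_i gamma_j when n(C) is odd and to 0 when n(C) is even:
   the quadratic relations become (3) and (1). *)

From HB Require Import structures.
Require Import Defs.
From mathcomp Require Import all_boot all_order all_algebra all_fingroup ring.
From mathcomp Require Import boolp classical_sets functions.
From mathcomp Require Import generic_quotient.
From mathcomp.multinomials Require Import monalg.

Set Implicit Arguments.
Unset Strict Implicit.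
Unset Printing Implicit Defensive.

Import GRing.Theory.

Local Open Scope classical_set_scope.
Local Open Scope ring_scope.

(** Apart from the underlying function a morphism record holds only proofs, equal by proof
    irrelevance. Uniqueness of extensions is an equality of such records. *)
Lemma lrmorphism_ext (R : pzSemiRingType) (A : lSemiAlgType R)
    (B : pzSemiRingType) (s : R -> B -> B) (f g : {lrmorphism A -> B | s}) :
  f =1 g -> f = g.
Proof.
case: f g => f [[fN] [fM] [fZ]] [g [[gN] [gM] [gZ]]] /= /funext fg.
by case: _ / fg gN gM gZ => gN gM gZ; congr GRing.LRMorphism.Pack;
  congr GRing.LRMorphism.Class; congr (_ _); apply: Prop_irrelevance.
Qed.

(** * Universal property of the quotient algebra *)

Section QuotientLift.
Variables (k : fieldType) (A B : algType k) (J : proper_two_sided_ideal A).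
Variable f : {lrmorphism A -> B}.
Hypothesis fJ : forall x, ideal_set J x -> f x = 0.

Let Q := quotient_algebra J.

(** Evaluating [f] at a representative does not depend on the choice, because [f] vanishes on
    [J]. *)
Lemma quotient_lift_exists :
  exists fbar : {lrmorphism Q -> B},
    forall x, fbar (quotient_proj J x) = f x.
Proof.
pose fbar (y : Q) : B := f (repr y).
have fbarE x : fbar (quotient_proj J x) = f x.
  apply/subr0_eq; rewrite -rmorphB; apply: fJ.
  by apply/quotient_piP; rewrite reprK.
have fbar_lin : linear fbar.
  move=> c x y; have [u ->] := quotient_proj_surj x.
  have [v ->] := quotient_proj_surj y.
  by rewrite -linearP !fbarE linearP.
have fbar_mul : monoid_morphism fbar.
  split=> [|x y]; first by rewrite -(rmorph1 (quotient_proj J)) fbarE rmorph1.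
  have [u ->] := quotient_proj_surj x; have [v ->] := quotient_proj_surj y.
  by rewrite -rmorphM !fbarE rmorphM.
pose fl := GRing.isLinear.Build k Q B *:%R fbar fbar_lin.
pose fm := GRing.isMonoidMorphism.Build Q B fbar fbar_mul.
pose F : {lrmorphism Q -> B} := HB.pack fbar fl fm.
by exists F.
Qed.

End QuotientLift.

(** * Morphisms out of the free algebra *)

Section FreeAlgebraMorphisms.
Variables (k : fieldType) (I : choiceType).
Local Notation F := (free_algebra k I).

(** Left multiplication by generators produces all words from 1, and every element is a finite
    linear combination of words. *)
Lemma free_algebra_ind (P : F -> Prop) :
    P 1 -> (forall i x, P x -> P (free_gen k i * x)) ->
    (forall c x y, P x -> P y -> P (c *: x + y)) ->
  forall x, P x.
Proof.
move=> P1 Pgen Plin x.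
(* Zero is the combination [-1 *: 1 + 1]. *)
have P0 : P 0 by rewrite -(subrr 1) addrC -scaleN1r; apply: Plin.
have PU (m : {fmonom I}) : P (mkmalgU m 1).
  case: m; elim=> [|i s IHs]; first by rewrite -fmoneE.
  have := Pgen i _ IHs; rewrite [_ * _]fgmulUU mulr1; congr (P (mkmalgU _ _)).
  by apply/eqP; rewrite fmP fmM fmU.
rewrite [x]monalgE; elim/big_rec: _ => // m y _ Py.
rewrite (_ : mkmalgU m _ = x@_m *: (mkmalgU m 1 : F)); first exact: Plin.
by rewrite -[RHS]mul_malgC [RHS]fgmulUU mul1m mulr1.
Qed.

Lemma free_algebra_lrmorphism_ext (B : algType k) (f g : {lrmorphism F -> B}) :
  (forall i, f (free_gen k i) = g (free_gen k i)) -> f =1 g.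
Proof.
move=> fg; apply: free_algebra_ind => [|i x fgx|c x y fgx fgy].
- by rewrite !rmorph1.
- by rewrite !rmorphM /= fg fgx.
- by rewrite !linearP /= fgx fgy.
Qed.

(** The target is [k^o], the field as an algebra over itself, so that the evaluation can be lifted
    to a quotient. *)
Lemma free_eval_lrmorphism (w : I -> k) :
  exists f : {lrmorphism F -> k^o}, forall x, f x = free_eval w x.
Proof.
pose f (x : F) : k^o := free_eval w x.
have f_lin : linear f.
  by move=> c x y; rewrite /f raddfD /= free_evalZ.
have f_mul : monoid_morphism f.
  by split=> [|x y]; rewrite /f ?rmorph1 ?rmorphM.
pose fl := GRing.isLinear.Build k F k^o *:%R f f_lin.
pose fm := GRing.isMonoidMorphism.Build F k^o f f_mul.
by exists (HB.pack f fl fm : {lrmorphism F -> k^o}).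
Qed.

End FreeAlgebraMorphisms.

(** * Values of the quadratic polynomials on scalars *)

Section QuadraticRelations.
Variables (X : choiceType) (op : X -> X -> X) (k : fieldType).
Variables (q : X -> X -> k) (pick_pair : set (X * X) -> X * X).

Lemma lrmorph_phi (C : set (X * X)) (A B : lalgType k)
    (f : {lrmorphism A -> B}) (T : X -> A) :
  f (phi op q pick_pair C T) = phi op q pick_pair C (f \o T).
Proof.
rewrite /phi raddf_sum /=; apply: eq_bigr => h _.
by rewrite linearZ /= rmorphM.
Qed.

Lemma phi_scalars (C : set (X * X)) (gamma : X -> k) :
    (forall i j, gamma j = q i j * gamma (op i j)) ->
  phi op q pick_pair C (gamma : X -> k^o) =
  if odd (class_size C)
  then gamma (pick_pair C).1 * gamma (pick_pair C).2 else 0.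
Proof.
move=> gammaE; rewrite /phi; set i := class_seq op (pick_pair C).
have term h : eta op q pick_pair C h *: (gamma (i h.+1) * gamma (i h) : k^o) =
    (-1) ^+ h * (gamma (pick_pair C).1 * gamma (pick_pair C).2).
  rewrite /GRing.scale /= /eta -/i -mulrA; congr (_ * _).
  elim: h => [|h IHh]; first by rewrite big_ord0 mul1r.
  rewrite big_ord_recr /= -IHh -mulrA; congr (_ * _).
  (* Since [i h.+2] is [op (i h.+1) (i h)], the hypothesis trades [gamma (i h)] for
     [q (i h.+1) (i h) * gamma (i h.+2)]. *)
  by rewrite -/(i h.+2) -/(i h.+1) -/(i h) (gammaE (i h.+1) (i h)); ring.
transitivity (\sum_(h < class_size C)
    (-1) ^+ h * (gamma (pick_pair C).1 * gamma (pick_pair C).2)).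
  by apply: eq_bigr => h _; apply: term.
rewrite -big_distrl /=.
(* The alternating sum of signs is 1 for an odd number of terms and 0 for an even one. *)
elim: (class_size C) => [|n IHn]; first by rewrite big_ord0 mul0r.
rewrite big_ord_recr mulrDl {}IHn /= -signr_odd.
by case: (odd n); rewrite /= ?expr1 ?mulN1r ?subrr ?add0r ?mul1r.
Qed.

End QuadraticRelations.

(** * Extensions of a character and their scalars *)

Section LiftingMorphisms.
Variables (k : fieldType) (D : quadratic_lifting_datum k) (rho : ld_G D -> k).
Hypothesis rho_char : is_linear_character rho.

(** The quadratic relations under [a_l] to [gamma l], [H_t] to [rho t], before splitting by the
    parity of the class size. *)
Definition quadratic_condition (gamma : ld_X D -> k) : Prop :=
  forall C, ld_classes C ->
    ld_phi C (gamma : ld_X D -> k^o) = ld_lambda C * (1 - rho (ld_gg C)).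

Lemma quadratic_conditionE gamma : invariant_family gamma ->
  quadratic_condition gamma <-> even_condition rho /\ odd_condition rho gamma.
Proof.
move=> gamma_inv.
have phiE C : ld_phi C (gamma : ld_X D -> k^o) = if odd (class_size C)
    then gamma (ld_pair C).1 * gamma (ld_pair C).2 else 0.
  apply: phi_scalars => i j.
  by rewrite {1}(gamma_inv (ld_g i) j) /ld_chi /ld_g /ld_act yd_chi_g yd_act_g.
split=> [quad|[even_rho odd_gamma] C DC].
  split=> C DC C_par; rewrite -quad // phiE ?C_par //.
  by rewrite (negPf C_par).
rewrite phiE; case: ifPn => C_par; [exact: odd_gamma | exact: even_rho].
Qed.

(** Multiplicativity makes [rho 1] idempotent, and it is nonzero. *)
Lemma rho_one : rho 1%g = 1.
Proof.
case: rho_char => rho_neq0 rhoM; apply: (mulfI (rho_neq0 1%g)).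
by rewrite -rhoM mulg1 mulr1.
Qed.

Lemma lifting_relator_eq0 x : lifting_relator x ->
  quotient_proj (lifting_ideal D) x = 0.
Proof. by move=> Dx; apply/eqP/quotient_projP => J _; apply. Qed.

Lemma extension_scalars (rhobar : {lrmorphism lifting_algebra D -> k^o}) :
    extends rho rhobar ->
  let gamma l : k := rhobar (lifting_a l) in
  invariant_family gamma /\ quadratic_condition gamma.
Proof.
move=> rhobarH gamma; have [rho_neq0 _] := rho_char.
pose p : {lrmorphism _ -> lifting_algebra D} := quotient_proj (lifting_ideal D).
have [f fE] : exists f : {lrmorphism free_algebra k (ld_generators D) -> k^o},
    forall x, f x = rhobar (p x) by exists (rhobar \o p).
have f0 x : lifting_relator x -> f x = 0.
  by move=> /lifting_relator_eq0 px0; rewrite fE /= px0 raddf0.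
have fH t : f (free_H t) = rho t by rewrite fE rhobarH.
have fa l : f (free_a l) = gamma l by rewrite fE.
split=> [t l|C DC].
  have := f0 _ (relator_act t l).
  rewrite rmorphB /= linearZ !rmorphM /= !fH !fa => /subr0_eq E.
  (* The commutation relator yields invariance only up to the factor [rho t], which is cancelled. *)
  by apply: (mulfI (rho_neq0 t)); rewrite E /GRing.scale /=; ring.
have := f0 _ (relator_quad DC).
rewrite raddfB /= linearZ raddfB /= rmorph1 fH lrmorph_phi => /subr0_eq E.
rewrite -[RHS]E; congr phi; apply/funext => l; apply/esym/fa.
Qed.

(** Evaluation of the free algebra at [gamma] and [rho] kills all relators, so it descends to the
    quotient. *)
Lemma extension_exists (gamma : ld_X D -> k) :
    invariant_family gamma -> quadratic_condition gamma ->
  exists2 rhobar : {lrmorphism lifting_algebra D -> k^o},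
    extends rho rhobar & forall l, rhobar (lifting_a l) = gamma l.
Proof.
move=> gamma_inv gamma_quad.
pose w (x : ld_generators D) : k :=
  match x with inl l => gamma l | inr t => rho t end.
have [f fE] := free_eval_lrmorphism w.
have fH t : f (free_H t) = rho t by rewrite fE free_eval_gen.
have fa l : f (free_a l) = gamma l by rewrite fE free_eval_gen.
have [|rhobar rhobarE] := @quotient_lift_exists _ _ _ (lifting_ideal D) f.
  (* The kernel of [f] is a two-sided ideal, so it contains the generated ideal once it contains the
     relators. *)
  move=> x /(_ [set y | f y = 0]); apply.
    split=> [|y z y0 z0|y z t z0] /=.
    - by rewrite raddf0.
    - by rewrite raddfD /= y0 z0 addr0.
    - by rewrite !rmorphM /= z0 mulr0 mul0r.
  have [_ rhoM] := rho_char; move=> y [|t s|t l|C DC] /=.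
  - by rewrite rmorphB /= rmorph1 fH rho_one subrr.
  - by rewrite rmorphB rmorphM /= !fH rhoM subrr.
  - rewrite rmorphB /= linearZ !rmorphM /= !fH !fa (gamma_inv t l).
    by rewrite /GRing.scale /=; ring.
  - rewrite raddfB /= linearZ raddfB /= rmorph1 fH.
    rewrite lrmorph_phi; apply/eqP; rewrite subr_eq0; apply/eqP.
    by rewrite -[RHS]gamma_quad //; congr phi; apply/funext => l; exact: fa.
by exists rhobar => [t|l]; rewrite rhobarE.
Qed.

(** The composites with the surjective projection agree on the generators of the free algebra. *)
Lemma extension_unique (f g : {lrmorphism lifting_algebra D -> k^o}) :
    extends rho f -> extends rho g ->
    (forall l, f (lifting_a l) = g (lifting_a l)) ->
  f = g.
Proof.
move=> fH gH fg_a; apply: lrmorphism_ext => y.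
have [x ->] := quotient_proj_surj y.
pose p : {lrmorphism _ -> lifting_algebra D} := quotient_proj (lifting_ideal D).
apply: (@free_algebra_lrmorphism_ext k _ k^o (f \o p) (g \o p)) => -[l|t] /=.
  exact: fg_a.
by rewrite -[LHS]/(f (lifting_H t)) -[RHS]/(g (lifting_H t)) fH gH.
Qed.

End LiftingMorphisms.

(** * Existence criterion, bijection and the zero family *)

Theorem proposition3p1 (k : closedFieldType) (k_char0 : [pchar k] =i pred0)
    (D : quadratic_lifting_datum k) (rho : ld_G D -> k)
    (rho_char : is_linear_character rho) :
  [/\ (exists rhobar : {lrmorphism lifting_algebra D -> k^o},
         extends rho rhobar)
      <->
      even_condition rho /\
      (exists gamma : ld_X D -> k,
         invariant_family gamma /\ odd_condition rho gamma),
      even_condition rho ->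
        set_bij
          [set rhobar : {lrmorphism lifting_algebra D -> k^o} |
             extends rho rhobar]
          [set gamma : ld_X D -> k |
             invariant_family gamma /\ odd_condition rho gamma]
          (fun rhobar l => rhobar (lifting_a l)) &
      (forall C : set (ld_X D * ld_X D),
         ld_classes C -> ld_lambda C != 0 -> rho (ld_gg C) = 1) ->
        exists rhobar0 : {lrmorphism lifting_algebra D -> k^o},
          [/\ extends rho rhobar0,
              forall l, rhobar0 (lifting_a l) = 0 &
              (forall l : ld_X D, ld_chi l (ld_g l) != 1) ->
                forall rhobar : {lrmorphism lifting_algebra D -> k^o},
                  extends rho rhobar -> rhobar = rhobar0]].
Proof.
have ext_scalars (f : {lrmorphism lifting_algebra D -> k^o}) :
    extends rho f ->
    [/\ even_condition rho, invariant_family (fun l => f (lifting_a l) : k) &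
        odd_condition rho (fun l => f (lifting_a l) : k)].
  case/(extension_scalars rho_char) => inv /(quadratic_conditionE _ inv).
  by case.
have ext_exists gamma : even_condition rho -> invariant_family gamma ->
    odd_condition rho gamma ->
    exists2 f : {lrmorphism lifting_algebra D -> k^o},
      extends rho f & forall l, f (lifting_a l) = gamma l.
  move=> even_rho inv odd_gamma; apply: extension_exists => //.
  exact/quadratic_conditionE.
split.
- split=> [[f /ext_scalars[even_rho inv odd_f]]|[even_rho [gamma [inv odd_g]]]].
    by split=> //; exists (fun l => f (lifting_a l)).
  by have [f fH _] := ext_exists gamma even_rho inv odd_g; exists f.
- move=> even_rho; split.
  + by move=> f /ext_scalars[].
  + move=> f g /set_mem fH /set_mem gH fg.
    by apply: (extension_unique fH gH) => l; apply: (congr1 (@^~ l) fg).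
  + move=> gamma [inv odd_g].
    have [f fH fa] := ext_exists gamma even_rho inv odd_g.
    by exists f => //; apply/funext => l; apply: fa.
- move=> lambda_rho.
  (* Either factor may vanish; in both cases the zero family meets the even and the odd
     conditions. *)
  have rhs0 C : ld_classes C -> ld_lambda C * (1 - rho (ld_gg C)) = 0.
    move=> DC; have [->|/lambda_rho-> //] := eqVneq (ld_lambda C) 0.
      by rewrite mul0r.
    by rewrite subrr mulr0.
  have [|t j|C DC _|f0 f0H f0a] := ext_exists (fun=> 0).
  + by move=> C DC _; rewrite rhs0.
  + by rewrite mulr0.
  + by rewrite rhs0 // mulr0.
  exists f0; split=> // chi_neq1 f fH.
  apply: (extension_unique fH f0H) => l; rewrite f0a.
  (* As [g_l] fixes [l], invariance at [g_l] reads [gamma l = chi_l(g_l) * gamma l], forcing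
     [gamma l = 0] when [chi_l(g_l)] is not 1. *)
  have [_ /(_ (ld_g l) l) + _] := ext_scalars f fH.
  have [_ _ _ opxx] := ld_rack D; rewrite /ld_act /ld_g yd_act_g opxx.
  move/eqP; rewrite -subr_eq0 -{1}[f _]mul1r -mulrBl mulf_eq0 subr_eq0 eq_sym.
  by rewrite (negPf (chi_neq1 l)) => /eqP.
Qed.
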